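(* There exists a constant $c$ such that for every integer $n\ge 3$, $$\lfloor \log_2 (2(n+1))\rfloor \le \mathrm{poly}_{\mathrm{F}_2}(K_n)\le \mathrm{poly}_{\mathrm{HC}}(K_n)\le \lfloor \log_2 n\rfloor + c.$$ Moreover, $\lfloor \log_2 \tfrac{8(n-1)}{3}\rfloor \le \mathrm{poly}_{\mathrm{HC}}(K_n)$ for every $n\ge 3$.
   Context: $\mathrm{F}_2(n)$ denotes the family of all $2$-factors (spanning $2$-regular subgraphs) of $K_n$, and $\mathrm{HC}(n)$ the family of all Hamiltonian cycles of $K_n$. For a graph $G$ and a family $\mathcal{H}$ of subgraphs of $G$, an edge-coloring of $G$ is $\mathcal{H}$-polychromatic if every graph in $\mathcal{H}$ contains, on its edges, every color that is used on the edges of $G$. The $\mathcal{H}$-polychromatic number $\mathrm{poly}_{\mathcal{H}}(G)$ is the largest number of colors used in an $\mathcal{H}$-polychromatic edge-coloring of $G$. *)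

(* Defs.v *)
From mathcomp Require Import all_boot all_order all_algebra.
From mathcomp Require Import all_classical all_reals all_analysis.

Set Implicit Arguments.
Unset Strict Implicit.
Unset Printing Implicit Defensive.

Import Order.TTheory GRing.Theory Num.Theory.

(* A graph on the vertex type T is given by its set of edges, an edge being
   a two-element set of vertices; a spanning subgraph is given by a subset of
   the edges, so a family of spanning subgraphs is a set of sets of edges. *)
Section Polychromatic.

Variable T : finType.
Implicit Types (E F : {set {set T}}) (H : {set {set {set T}}}).

(* Only the values of [f] on [E] matter. *)
Definition polychromatic (C : finType) E H (f : {ffun {set T} -> C}) : bool :=
  [forall F in H, f @: E \subset f @: F].

(* A coloring uses at most #|E| colors on E, so, up to renaming the colors,
   the palette 'I_#|E| accounts for all colorings. *)
Definition poly_number E H : nat :=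
  \max_(f : {ffun {set T} -> 'I_#|E|} | polychromatic E H f) #|f @: E|.

Definition complete_edges : {set {set T}} := [set e : {set T} | #|e| == 2].

Definition two_factor F : bool :=
  (F \subset complete_edges) &&
  [forall v, #|[set e in F | v \in e]| == 2].

(* [s] lists every vertex exactly once, and [next s] is the cyclic successor. *)
Definition hamiltonian_cycle F : bool :=
  (2 < #|T|) &&
  [exists s : #|T|.-tuple T, uniq s && (F == [set [set x; next s x] | x : T])].

End Polychromatic.

Definition K (n : nat) : {set {set 'I_n}} := complete_edges 'I_n.

Definition F2 (n : nat) : {set {set {set 'I_n}}} := [set F | two_factor F].

Definition HC (n : nat) : {set {set {set 'I_n}}} :=
  [set F | hamiltonian_cycle F].

Definition floor_log2 (R : realType) (x : R) : int :=
  Num.floor (ln x / ln 2)%R.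

(* Main.v *)
(** Lower bounds: order the vertices and let an edge inherit the color of its
    first vertex, except that the edge between the first and third vertices gets
    color 2.  The first three colors then meet every 2-factor.  Another color is
    given to a block of consecutive vertices [a, b); a 2-factor avoiding it joins
    the block only to earlier vertices, so b - a <= a by double counting, and
    if b - a = a then [0, b) is a union of cycles.

    Upper bound: for each color c, the edges not colored c contain no Hamiltonian
    cycle, so Pósa's theorem yields a set A_c of size a_c < n/2 whose vertices have
    at most a_c neighbors through edges not colored c.  At most 6 colors satisfy
    2 a_c = n - 1; for the others the sets A_c are disjoint.  Sort them by size as
    A_0, ..., A_(m-1).  An edge between A_i and A_j with i < j is not colored i or
    not colored j, so it is charged at one end at least; weighting the charges at
    A_j by w_j = 2^-j / a_j, and by half of that for j = 0, gives
    sum_j w_j a_j^2 >= sum_(i < j) w_j a_i a_j.  The difference telescopes to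
    (a_0 + ... + a_(m-1)) / 2^(m-1) - a_0 / 2 >= 0, hence 2^m <= 4n. *)
Require Import Defs.
From mathcomp Require Import all_boot all_order all_algebra.
From mathcomp Require Import all_classical all_reals all_analysis.
From mathcomp Require Import fintype finset zify ring lra.

Set Implicit Arguments.
Unset Strict Implicit.
Unset Printing Implicit Defensive.

Import Order.TTheory GRing.Theory Num.Theory.

(** * Neighborhoods, 2-factors and Hamiltonian cycles *)

Section Graphs.

Variable T : finType.
Implicit Types (E F G : {set {set T}}) (s : seq T) (u v w x y : T).

Definition nbrs F v : {set T} := [set w | [set v; w] \in F].

Lemma in_nbrs F v w : (w \in nbrs F v) = ([set v; w] \in F).
Proof. by rewrite inE. Qed.

Lemma nbrs_sym F v w : (w \in nbrs F v) = (v \in nbrs F w).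
Proof. by rewrite !inE setUC. Qed.

Lemma nbrsS F G v : F \subset G -> nbrs F v \subset nbrs G v.
Proof. by move=> /subsetP sFG; apply/subsetP => w; rewrite !inE => /sFG. Qed.

Lemma pair_complete x y : ([set x; y] \in complete_edges T) = (x != y).
Proof. by rewrite inE cards2; case: (x == y). Qed.

Lemma nbrs_neq F v w : F \subset complete_edges T -> w \in nbrs F v -> v != w.
Proof. by move=> /subsetP sF; rewrite in_nbrs => /sF; rewrite pair_complete. Qed.

Lemma set2_injr v : injective (fun w => [set v; w]).
Proof.
move=> w w' /= /setP e; have:= e w; have := e w'.
by rewrite !inE !eqxx !orbT; case: (eqVneq w' w) => // _; rewrite orbF => /eqP->;
  rewrite orbF => /esym/eqP.
Qed.

Lemma card_nbrs F v : F \subset complete_edges T ->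
  #|nbrs F v| = #|[set e in F | v \in e]|.
Proof.
move=> sF; rewrite -(card_imset _ (@set2_injr v)); congr #|pred_of_set _|.
apply/setP => e; rewrite inE; apply/imsetP/andP => [[w]|[eF ve]].
  by rewrite in_nbrs => vw ->; rewrite vw !inE eqxx.
have := subsetP sF _ eF; rewrite inE => /cards2P[a][b][ab e_ab].
move: eF ve; rewrite e_ab => eF; rewrite !inE => /orP[]/eqP ->.
  by exists b; rewrite ?in_nbrs.
by exists a; rewrite ?in_nbrs setUC.
Qed.

Lemma two_factor_nbrs F v : two_factor F -> #|nbrs F v| = 2.
Proof. by move=> /andP[sF /forallP dF]; rewrite card_nbrs //; apply/eqP. Qed.

Lemma mem_spanning s x : uniq s -> size s = #|T| -> x \in s.
Proof.
move=> us ss; have sub : {subset s <= enum T} by move=> y _; rewrite mem_enum.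
have [|_ ->] := uniq_min_size us sub; last by rewrite mem_enum.
by rewrite -cardE ss.
Qed.

Definition cycle_edges s : {set {set T}} := [set [set x; next s x] | x : T].

Lemma hamiltonianP F : 2 < #|T| ->
  reflect (exists s, [/\ uniq s, size s = #|T| & F = cycle_edges s])
          (hamiltonian_cycle F).
Proof.
move=> T2; rewrite /hamiltonian_cycle T2; apply: (iffP existsP) => /=.
  by move=> [s /andP[us /eqP ->]]; exists s; rewrite size_tuple.
move=> [s [us /eqP ss ->]]; exists (Tuple ss); rewrite us; exact/eqP.
Qed.

Lemma hamiltonian_cycle_gt2 F : hamiltonian_cycle F -> 2 < #|T|.
Proof. by case/andP. Qed.

(** The first inequality makes [[set x; next s x]] a genuine edge, the second makes the two cycle
    edges at a vertex distinct. *)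
Lemma next_spanning s x : uniq s -> size s = #|T| -> 2 < #|T| ->
  (next s x != x) && (next s (next s x) != x).
Proof.
move=> us ss T2; have xs := mem_spanning x us ss.
have [i q qE] := rot_to xs; rewrite -!(next_rot i us) qE.
have: uniq (x :: q) by rewrite -qE rot_uniq.
have: 2 < size (x :: q) by rewrite -qE size_rot ss.
case: q {qE} => [|y [|z r]] //= _; rewrite !inE !negb_or eqxx -!andbA.
move=> /and5P[xy xz _ yz _].
by rewrite eq_sym xy /= eq_sym (negbTE xy) eq_sym eqxx eq_sym xz.
Qed.

Lemma hamiltonian_two_factor F : hamiltonian_cycle F -> two_factor F.
Proof.
move=> hF; have T2 := hamiltonian_cycle_gt2 hF.
have /hamiltonianP-/(_ T2)[s [us ss ->]] := hF.
apply/andP; split.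
  apply/subsetP => _ /imsetP[x _ ->]; rewrite pair_complete eq_sym.
  by case/andP: (next_spanning x us ss T2).
apply/forallP => v.
suff -> : [set e in cycle_edges s | v \in e] =
          [set [set v; next s v]; [set prev s v; v]].
  rewrite cards2; have/andP[_] := next_spanning (prev s v) us ss T2.
  rewrite next_prev // => /negP nv.
  have/andP[/negP nv' _] := next_spanning v us ss T2.
  case: (eqVneq [set v; next s v]) => // /setP e; have := e (next s v); rewrite !inE eqxx orbT.
  by move=> /esym/orP[].
apply/setP => e; rewrite !inE; apply/andP/orP.
  move=> [/imsetP[x _ ->]]; rewrite !inE => /orP[]/eqP ->; first by left.
  by rewrite prev_next //; right.
move=> [] /eqP ->; split; rewrite ?inE ?eqxx ?orbT //; apply/imsetP.
  by exists v.
by exists (prev s v); rewrite ?next_prev.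
Qed.

Lemma hamiltonian_exists : 2 < #|T| -> exists F, hamiltonian_cycle F.
Proof.
move=> T2; exists (cycle_edges (enum T)); apply/hamiltonianP => //.
by exists (enum T); rewrite enum_uniq -cardE.
Qed.

(** Iterating [next s] from [z] stays in [Z] and visits every vertex. This connectedness, which
    2-factors may lack, is what improves the lower bound for Hamiltonian cycles. *)
Lemma hamiltonian_closed F (Z : {set T}) z : hamiltonian_cycle F ->
  z \in Z -> (forall v, v \in Z -> nbrs F v \subset Z) -> Z = setT.
Proof.
move=> hF zZ Zcl; have T2 := hamiltonian_cycle_gt2 hF.
have /hamiltonianP-/(_ T2)[s [us ss FE]] := hF.
have nZ v : v \in Z -> next s v \in Z.
  by move=> /Zcl/subsetP; apply; rewrite in_nbrs FE; apply/imsetP; exists v.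
have [i q qE] := rot_to (mem_spanning z us ss).
apply/setP => x; rewrite inE; move: x.
suff Zx x : x \in z :: q -> x \in Z.
  by move=> x; apply: Zx; rewrite -qE mem_rot mem_spanning.
have: fcycle (next s) (z :: q) by rewrite -qE rot_cycle cycle_next.
rewrite /= rcons_path => /andP[+ _] {qE}.
elim: q z zZ => [|y q IH] z zZ /=; first by rewrite inE => _ /eqP->.
move=> /andP[/eqP <- pq]; rewrite in_cons => /predU1P[-> //|]; apply: IH => //.
exact: nZ.
Qed.

End Graphs.

(** * Pósa's theorem for nonhamiltonian graphs *)

Section Posa.

Variable T : finType.
Implicit Types (E F G : {set {set T}}) (s q : seq T) (u v w x y : T).

Hypothesis T2 : 2 < #|T|.

Definition nonhamiltonian G : bool :=
  [forall F, hamiltonian_cycle F ==> ~~ (F \subset G)].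

Definition adj G : rel T := fun x y => [set x; y] \in G.

Lemma adjC G x y : adj G x y = adj G y x.
Proof. by rewrite /adj setUC. Qed.

Lemma nonhamiltonian_cycle G s :
  nonhamiltonian G -> uniq s -> size s = #|T| -> ~~ cycle (adj G) s.
Proof.
move=> /forallP nG us ss; apply/negP => cs.
have hF : hamiltonian_cycle (cycle_edges s).
  by apply/hamiltonianP => //; exists s.
have /implyP/(_ hF)/negP := nG (cycle_edges s); apply.
apply/subsetP => _ /imsetP[x _ ->]; exact: (next_cycle cs (mem_spanning x us ss)).
Qed.

(** Allows a spanning path to be read from whichever end is wanted. *)
Lemma rev_spanning_path G u q : uniq (u :: q) -> path (adj G) u q ->
  exists q', [/\ uniq (last u q :: q'), size q' = size q,
    last (last u q) q' = u & path (adj G) (last u q) q'].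
Proof.
move=> uq pq; exists (rev (belast u q)).
have revE : last u q :: rev (belast u q) = rev (u :: q).
  by rewrite [u :: q]lastI rev_rcons.
split; first by rewrite revE rev_uniq.
- by rewrite size_rev size_belast.
- by rewrite -(last_cons u) revE rev_cons last_rcons.
by rewrite rev_path; apply: sub_path pq => x y; rewrite adjC.
Qed.

(** The last vertex is exempt because its successor edge closes the cycle, and that edge may lie
    outside [G]. *)
Lemma fpath_adj G (f : T -> T) x q : uniq (x :: q) -> fpath f x q ->
  (forall z, z != last x q -> adj G z (f z)) -> path (adj G) x q.
Proof.
elim: q x => //= y q IH x /andP[xq uq] /andP[/eqP fx fq] adjf.
rewrite -{1}fx adjf ?IH //; apply: contraNneq xq => ->.
exact: (mem_last y q).
Qed.

(* A Hamiltonian cycle of [G + uv] uses [uv]. *)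
Lemma spanning_path G u v :
  nonhamiltonian G -> ~~ nonhamiltonian ([set u; v] |: G) -> u != v ->
  exists q, [/\ uniq (u :: q), size (u :: q) = #|T|, last u q = v
              & path (adj G) u q].
Proof.
move=> nG /forallPn[F]; rewrite negb_imply negbK => /andP[hF sF] uv.
have /hamiltonianP-/(_ T2)[s [us ss FE]] := hF.
have sE x : [set x; next s x] \in [set u; v] |: G.
  by apply: (subsetP sF); rewrite FE; apply/imsetP; exists x.
have [x xG] : exists x, ~~ adj G x (next s x).
  apply/existsP; rewrite -negb_forall; apply/negP => /forallP nxt.
  have /negP := nonhamiltonian_cycle nG us ss; apply.
  by apply: cycle_from_next => // y _; apply: nxt.
have xE : [set x; next s x] = [set u; v].
  by move: (sE x) xG; rewrite !inE /adj => /orP[/eqP//|->].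
have [i q qE] := rot_to (mem_spanning (next s x) us ss).
have uq : uniq (next s x :: q) by rewrite -qE rot_uniq.
have sq : size (next s x :: q) = #|T| by rewrite -qE size_rot.
have /= := cycle_next us; rewrite -(rot_cycle i) qE /= rcons_path.
move=> /andP[fq /eqP/(can_inj (prev_next us)) lq].
(* If the edge from [z] to [next s z] were [uv], it would be the edge at [x] traversed backwards, so
   [next s] would swap its ends, against [next_spanning]. *)
have adjn z : z != last (next s x) q -> adj G z (next s z).
  rewrite lq => zx; have := sE z; rewrite !inE -xE => /orP[|//] /eqP zE.
  have : z \in [set x; next s x] by rewrite -zE set21.
  rewrite !inE (negPf zx) => /eqP zn.
  have : x \in [set z; next s z] by rewrite zE set21.
  rewrite !inE eq_sym (negPf zx) zn eq_sym /=.
  by have /andP[_ /negPf->] := next_spanning x us ss T2.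
have pq := fpath_adj uq fq adjn.
have : u \in [set x; next s x] by rewrite xE set21.
have : v \in [set x; next s x] by rewrite xE set22.
rewrite !inE => /orP[]/eqP vE /orP[]/eqP uE; first by rewrite uE vE eqxx in uv.
- by exists q; rewrite uE lq vE.
- have [q' [uq' sq' lq' pq']] := rev_spanning_path uq pq.
  by exists q'; move: uq' lq' pq'; rewrite lq /= sq' -vE -uE.
by rewrite uE vE eqxx in uv.
Qed.

(* If some neighbour [w] of [u] had its predecessor [p] on the path adjacent to
   the end [v], then going from [u] to [p], jumping to [v], and going back to
   [w] would close a Hamiltonian cycle. *)
Lemma ore G u q : G \subset complete_edges T -> nonhamiltonian G ->
  uniq (u :: q) -> size (u :: q) = #|T| -> path (adj G) u q ->
  exists P : {set T}, [/\ #|P| = #|nbrs G u|, last u q \notin P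
    & forall p, p \in P -> p \notin nbrs G (last u q)].
Proof.
move=> sG nG uq sq pq.
have nq w : w \in nbrs G u -> w \in q.
  move=> wu; have := mem_spanning w uq sq; rewrite in_cons.
  by rewrite eq_sym (negPf (nbrs_neq sG wu)).
(* Indexing [u :: q] by a position in [q] shifts by one, which yields the predecessor of [w] on the
   path. *)
exists [set nth u (u :: q) (index w q) | w in nbrs G u]; split.
- rewrite card_in_imset // => w w' /nq wq /nq wq' /eqP.
  rewrite nth_uniq //= ?ltnS ?index_size // => /eqP e.
  by rewrite -(nth_index u wq) e nth_index.
- apply/imsetP => -[w /nq wq] /eqP; rewrite (last_nth u).
  by rewrite nth_uniq //= ?ltnS ?index_size // eqn_leq leqNgt index_mem wq.
move=> _ /imsetP[w wu ->]; have wq := nq _ wu.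
case/splitPr: wq uq sq pq => q1 q2 uq sq pq.
have wq1 : w \notin q1.
  by move: uq; rewrite /= cat_uniq /= negb_or => /and4P[_ _ /andP[]].
rewrite index_cat (negPf wq1) /= eqxx addn0 -cat_cons nth_cat /= ltnSn.
rewrite -last_nth last_cat /= in_nbrs; apply/negP => pv.
pose c := (u :: q1) ++ rev (w :: q2).
have uc : uniq c.
  by rewrite (@perm_uniq _ _ ((u :: q1) ++ w :: q2)) // perm_cat2l perm_rev.
have sc : size c = #|T| by rewrite -sq /= !size_cat size_rev.
have /negP := nonhamiltonian_cycle nG uc sc; apply.
move: pq; rewrite /= rcons_cat !cat_path /= => /and3P[-> _ wq2] /=.
have := rev_path (adj G) u (rcons (w :: q2) (last u q1)).
rewrite belast_rcons last_rcons rev_cons => ->; rewrite /= rcons_path.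
rewrite /= [adj G w u]adjC [adj G u w]/adj -in_nbrs wu /=.
rewrite [X in _ && X]/adj setUC pv andbT.
by apply: sub_path wq2 => x y; rewrite adjC.
Qed.

(** In a maximal nonhamiltonian supergraph [M], choose a nonadjacent pair [u], [v] with the largest
    degree sum and [d u <= d v]. The [d u] vertices that [ore] finds nonadjacent to [v] have degree
    at most [d u], by the choice of the pair. *)
Lemma posa G : G \subset complete_edges T -> nonhamiltonian G ->
  exists (i : nat) (A : {set T}), [/\ 0 < i, i.*2 < #|T|, #|A| = i
    & forall v, v \in A -> #|nbrs G v| <= i].
Proof.
move=> sG nG.
pose P (M : {set {set T}}) := (M \subset complete_edges T) && nonhamiltonian M.
have PG : P G by rewrite /P sG.
have [M /maxsetP[/andP[sM nM] Mmax] sGM] := maxset_exists PG.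
suff [i [A [i0 iT cA dA]]] : exists (i : nat) (A : {set T}),
    [/\ 0 < i, i.*2 < #|T|, #|A| = i & forall v, v \in A -> #|nbrs M v| <= i].
  exists i, A; split=> // v vA; apply: leq_trans (dA v vA).
  exact/subset_leq_card/nbrsS.
pose d x := #|nbrs M x|.
pose R (p : T * T) := (p.1 != p.2) && ([set p.1; p.2] \notin M).
have [p0 Rp0] : exists p, R p.
  have [F hF] := hamiltonian_exists T2.
  have /forallP/(_ F) := nM; rewrite hF /= => nF.
  have : ~~ (complete_edges T \subset M).
    apply: contra nF => /(fintype.subset_trans _); apply.
    by case/andP: (hamiltonian_two_factor hF).
  case/subsetPn => e; rewrite inE => /cards2P[x][y][xy ->] nxy.
  by exists (x, y); rewrite /R /= xy.
have [[u v] Ruv uvmax] := arg_maxnP (fun p => d p.1 + d p.2) Rp0.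
wlog duv : u v Ruv uvmax / d u <= d v.
  move=> W; have [|/ltnW] := leqP (d u) (d v); first exact: W.
  apply: W; first by move: Ruv; rewrite /R /= eq_sym setUC.
  by move=> p /uvmax /=; rewrite (addnC (d v)).
have /andP[/= uv nuv] := Ruv.
have [q [uq sq lq pq]] : exists q, [/\ uniq (u :: q), size (u :: q) = #|T|,
    last u q = v & path (adj M) u q].
  apply: spanning_path => //; apply: contra nuv => nM'.
  rewrite -(Mmax ([set u; v] |: M)) ?setU11 ?subsetUr // /P nM' andbT.
  by rewrite subUset sM andbT sub1set pair_complete.
have [B [cB vB dB]] := ore sM nM uq sq pq.
rewrite lq in vB dB.
(* [B] and the neighborhood of [v] are disjoint and both miss [v]; with [d u <= d v] this gives the
   bound on [i.*2]. *)
have duv_lt : d u + d v < #|T|.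
  have /subset_leq_card : B :|: nbrs M v \subset [set~ v].
    apply/subsetP => x; rewrite in_setU in_setC1 => /orP[xB|xv].
      by apply: contraNneq vB => <-.
    by rewrite eq_sym (nbrs_neq sM xv).
  have /eqP I0 : B :&: nbrs M v == set0.
    by apply/set0Pn => -[x /setIP[/dB/negP]].
  have := cardsUI B (nbrs M v); rewrite I0 cards0 cB cardsC1 -/(d u) -/(d v).
  lia.
have dBu p : p \in B -> d p <= d u.
  move=> pB; have pv : R (p, v).
    rewrite /R /= -in_nbrs nbrs_sym dB // andbT.
    by apply: contraNneq vB => <-.
  by have := uvmax _ pv; rewrite /= leq_add2r.
(* [i] must be positive, so an isolated [u] is treated apart, with [i = 1]. *)
have [du0|du0] := posnP (d u).
  exists 1, [set u]; split; rewrite ?cards1 //.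
  by move=> x /set1P ->; rewrite -/(d u) du0.
exists (d u), B; split=> //.
by apply: leq_ltn_trans duv_lt; rewrite -addnn leq_add2l.
Qed.

End Posa.

(** * The weighted inequality for set sizes [a j] and charge counts [N j l] *)

Section Doubling.
Local Open Scope ring_scope.

Variables (m : nat) (a : nat -> rat) (N : nat -> nat -> rat).
Hypothesis a_gt0 : forall j, (j < m)%N -> 0 < a j.
Hypothesis a_le : forall i j, (i < j < m)%N -> a i <= a j.
Hypothesis N_le : forall j, (j < m)%N -> \sum_(l < m) N j l <= a j ^+ 2.
Hypothesis N_ge0 : forall i j, 0 <= N i j.
Hypothesis N_ge : forall i j, (i < j < m)%N -> a i * a j <= N i j + N j i.

Let S j := \sum_(i < j) a i.

(* With the uniform choice [2^-j], the weighted inequality below would only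
   give [0 <= S m]. *)
Let u (j : nat) : rat := if j is 0%N then 2^-1 else 2^-1 ^+ j.
Let w j := u j / a j.

Let u_gt0 j : 0 < u j.
Proof. by case: j => [|j] /=; rewrite ?exprn_gt0. Qed.

Let w_ge0 j : (j < m)%N -> 0 <= w j.
Proof. by move=> jm; rewrite divr_ge0 // ltW ?a_gt0. Qed.

Let u_le i j : (i <= j)%N -> u j <= u i.
Proof.
case: i j => [|i] [|j] //= ij; last by rewrite ler_wiXn2l ?lef_pV2 //; lra.
by rewrite -[leRHS]expr1 ler_wiXn2l //; lra.
Qed.

Let w_le i j : (i < j < m)%N -> w j <= w i.
Proof.
move=> /andP[ij jm]; have im := ltn_trans ij jm.
apply: ler_pM; rewrite ?invr_ge0 ?(ltW (u_gt0 _)) ?(ltW (a_gt0 _)) //.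
  by rewrite u_le // ltnW.
by rewrite lef_pV2 ?posrE ?a_gt0 // a_le // ij.
Qed.

(** Induction on [p]: the charges between a new index [p] and some [j < p] number at least
    [a j * a p], and those made at [j] carry the weight [w j >= w p]. *)
Let charge p : (p <= m)%N ->
  \sum_(j < p) w j * (a j * S j) <= \sum_(j < p) w j * \sum_(l < p) N j l.
Proof.
elim: p => [|p IH] pm; first by rewrite !big_ord0.
rewrite !big_ord_recr /=.
under [X in _ <= X + _]eq_bigr do rewrite big_ord_recr /= mulrDr.
rewrite big_split /= -addrA lerD ?IH ?(ltnW pm) //.
apply: (@le_trans _ _ (\sum_(j < p) w p * (N j p + N p j))).
  rewrite -mulr_sumr ler_wpM2l ?w_ge0 // mulrC mulr_suml ler_sum // => j _.
  by rewrite N_ge // ltn_ord.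
under [X in X <= _]eq_bigr do rewrite mulrDr.
rewrite big_split /= lerD //.
  by rewrite ler_sum // => j _; rewrite ler_wpM2r // w_le // ltn_ord.
by rewrite -mulr_sumr ler_wpM2l ?w_ge0 // lerDl.
Qed.

Let telescope p :
  \sum_(j < p.+1) u j * (a j - S j) = 2^-1 ^+ p * S p.+1 - a 0%N / 2.
Proof.
elim: p => [|p IH].
  by rewrite /S !big_ord_recr !big_ord0 /=; field.
rewrite big_ord_recr /= IH [S p.+2]/S big_ord_recr /= -/(S p.+1) exprS.
by field.
Qed.

Lemma doubling : (0 < m)%N -> a 0%N * 2 ^+ m <= 4 * \sum_(j < m) a j.
Proof.
case: m a_gt0 N_le charge => // p a0 Nl ch _.
have : 0 <= 2^-1 ^+ p * S p.+1 - a 0%N / 2.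
  rewrite -telescope.
  have -> : \sum_(j < p.+1) u j * (a j - S j) =
      \sum_(j < p.+1) w j * a j ^+ 2 - \sum_(j < p.+1) w j * (a j * S j).
    rewrite -sumrB; apply: eq_bigr => j _; rewrite /w.
    by have /gt_eqF/negbT := a0 j (ltn_ord j); move=> aj; field.
  rewrite subr_ge0; apply: le_trans (ch _ (leqnn _)) _.
  rewrite ler_sum // => j _; rewrite ler_wpM2l ?Nl //.
  by rewrite divr_ge0 // ltW ?a0.
rewrite subr_ge0 -/(S p.+1).
have P : 0 < 2 ^+ p :> rat by rewrite exprn_gt0.
rewrite exprVn [leRHS]mulrC ler_pdivlMr // exprS.
lra.
Qed.

End Doubling.

(** * Counting the colors that admit a Pósa set *)

Section UpperBound.

Lemma sum_card_disjoint (T I : finType) (D : {set T}) (B : I -> {set T}) :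
  (forall i j x, x \in B i -> x \in B j -> i = j) ->
  \sum_i #|D :&: B i| <= #|D|.
Proof.
move=> disj.
under eq_bigr do (rewrite -sum1_card; under eq_bigl do rewrite in_setI;
  rewrite big_mkcondr).
rewrite exchange_big -[leqRHS]sum1_card leq_sum // => x _.
have [i xi|nx] := pickP (fun i => x \in B i); last first.
  by rewrite big1 // => i _; have /= -> := nx i.
rewrite (bigD1 i) //= xi big1 ?addn0 // => j; case: ifP => // xj.
by rewrite (disj _ _ _ xi xj) eqxx.
Qed.

Variables (T C : finType) (f : {set T} -> C).
Implicit Types (v w x y : T) (c d : C) (A : {set T}).

Definition on_color c v : {set T} := [set w | (v != w) && (f [set v; w] == c)].
Definition off_color c v : {set T} := [set w | (v != w) && (f [set v; w] != c)].

Lemma card_on_off c v : #|on_color c v| + #|off_color c v| = #|T|.-1.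
Proof.
rewrite -(cardsC1 v) -(cardsID (on_color c v) [set~ v]); congr (_ + _);
  apply: eq_card => w; rewrite !inE eq_sym; case: (w == v) => //=.
by rewrite andbT.
Qed.

Lemma sum_card_on_color v : \sum_c #|on_color c v| = #|T|.-1.
Proof.
rewrite -(cardsC1 v) -sum1_card (partition_big (fun w => f [set v; w]) xpredT) //.
apply: eq_bigr => c _; rewrite -sum1_card; apply: eq_bigl => w.
by rewrite !inE eq_sym.
Qed.

Variable A : C -> {set T}.

(** The conclusion of Pósa's theorem for the graph of the edges not colored [c]. *)
Definition posa_set c : bool :=
  [&& 0 < #|A c|, #|A c|.*2 < #|T| & [forall v in A c, #|off_color c v| <= #|A c|]].

Lemma posa_setP c v : posa_set c -> v \in A c -> #|off_color c v| <= #|A c|.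
Proof. by case/and3P => _ _ /forall_inP; apply. Qed.

(* Such a color occupies about a quarter of the edges. *)
Lemma large_colors : 2 < #|T| ->
  #|[set c | posa_set c && (#|A c|.*2 == #|T|.-1)]| <= 6.
Proof.
set J := [set c | _]; move=> T2.
have : \sum_(c in J) \sum_(v in A c) #|on_color c v| <= #|T| * #|T|.-1.
  apply: (@leq_trans (\sum_c \sum_v #|on_color c v|)).
    rewrite big_mkcond leq_sum // => c _; case: ifP => // _.
    by rewrite big_mkcond leq_sum // => v _; case: ifP.
  rewrite exchange_big /=; under eq_bigr do rewrite sum_card_on_color.
  by rewrite sum_nat_const.
(* Put [t = #|T|]. Each of the [(t-1)/2] vertices of [A c] has at least [(t-1)/2] edges of color
   [c], so [c] takes at least [(t-1)^2/4] of the [t(t-1)] ordered pairs; and [4t/(t-1) <= 6] for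
   [t >= 3]. *)
have : \sum_(c in J) (#|T|.-1 * #|T|.-1) <=
       4 * \sum_(c in J) \sum_(v in A c) #|on_color c v|.
  rewrite big_distrr /= leq_sum // => c; rewrite inE => /andP[pc /eqP cE].
  have : \sum_(v in A c) #|A c| <= \sum_(v in A c) #|on_color c v|.
    apply: leq_sum => v vA; have := posa_setP pc vA; have := card_on_off c v.
    by lia.
  rewrite sum_nat_const -cE -muln2 mulnACA mulnC leq_pmul2l //.
rewrite sum_nat_const; nia.
Qed.

Definition small_color : {set C} :=
  [set c | posa_set c && (#|A c|.*2 < #|T|.-1)].

(** At a vertex of [A c] more than half of the edges have color [c], which cannot happen for two
    colors at once. *)
Lemma small_color_disjoint c d v : c \in small_color -> d \in small_color ->
  v \in A c -> v \in A d -> c = d.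
Proof.
rewrite !inE => /andP[pc sc] /andP[pd sd] vc vd; apply/eqP/negPn/negP => cd.
have : #|on_color c v| <= #|off_color d v|.
  apply/subset_leq_card/subsetP => w; rewrite !inE => /andP[-> /eqP ->] //=.
have := posa_setP pc vc; have := posa_setP pd vd; have := card_on_off c v.
lia.
Qed.

(** The charges at [A c] coming from edges to [A d]. *)
Let N c d := \sum_(x in A c) #|off_color c x :&: A d|.

Lemma small_colors : 0 < #|T| -> 2 ^ #|small_color| <= 4 * #|T|.
Proof.
move=> T0; have [->|[c0 c0s]] := set_0Vmem small_color.
  by rewrite cards0; lia.
have m0 : 0 < #|small_color| by apply/card_gt0P; exists c0.
pose s := sort (fun c d => #|A c| <= #|A d|) (enum small_color).
pose c_ := nth c0 s.
have ss : size s = #|small_color| by rewrite size_sort cardE.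
have us : uniq s by rewrite sort_uniq enum_uniq.
have c_s j : j < #|small_color| -> c_ j \in small_color.
  by move=> jm; rewrite -mem_enum -(mem_sort (fun c d => #|A c| <= #|A d|)) mem_nth ?ss.
have c_disj i j x : i < #|small_color| -> j < #|small_color| ->
    x \in A (c_ i) -> x \in A (c_ j) -> i = j.
  move=> im jm xi xj.
  have /eqP := small_color_disjoint (c_s _ im) (c_s _ jm) xi xj.
  by rewrite nth_uniq ?ss // => /eqP.
have c_disj' (i j : 'I_#|small_color|) x :
    x \in A (c_ i) -> x \in A (c_ j) -> i = j.
  by move=> xi xj; apply: val_inj; apply: (c_disj i j x).
have le_sum : \sum_(j < #|small_color|) #|A (c_ j)| <= #|T|.
  rewrite -cardsT; apply: leq_trans (sum_card_disjoint setT c_disj').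
  by apply: leq_sum => j _; rewrite setTI.
have le_s i j : i < j < #|small_color| -> #|A (c_ i)| <= #|A (c_ j)|.
  move=> /andP[ij jm].
  have tr : transitive (fun c d => #|A c| <= #|A d|).
    by move=> ? ? ?; apply: leq_trans.
  have so : sorted (fun c d => #|A c| <= #|A d|) s.
    by apply: sort_sorted => c d; apply: leq_total.
  apply: (sorted_leq_nth tr (fun c => leqnn _) c0 so) (ltnW ij);
    by rewrite inE ss // (ltn_trans ij).
have c_gt0 j : j < #|small_color| -> 0 < #|A (c_ j)|.
  by move=> /c_s; rewrite inE => /andP[/and3P[]].
have N_le j : j < #|small_color| ->
    \sum_(l < #|small_color|) N (c_ j) (c_ l) <= #|A (c_ j)| ^ 2.
  move=> /c_s; rewrite inE => /andP[pj _].
  rewrite exchange_big /= -mulnn -sum_nat_const leq_sum // => x xj.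
  (* As the sets are disjoint, each edge at [x] not colored [c_ j] is charged for at most one
     [l]. *)
  by apply: leq_trans (posa_setP pj xj); apply: sum_card_disjoint c_disj'.
have N_ge i j : i < j < #|small_color| ->
    #|A (c_ i)| * #|A (c_ j)| <= N (c_ i) (c_ j) + N (c_ j) (c_ i).
  move=> /andP[ij jm]; have im := ltn_trans ij jm.
  have NE c d : N c d = \sum_(x in A c) \sum_(y in A d) (y \in off_color c x).
    apply: eq_bigr => x _; rewrite setIC -sum1_card big_mkcond [RHS]big_mkcond.
    by apply: eq_bigr => y _; rewrite in_setI; case: (y \in A d).
  rewrite !NE [X in _ <= _ + X]exchange_big -big_split /= -sum_nat_const.
  rewrite leq_sum // => x xi; rewrite -big_split -sum1_card leq_sum //= => y yj.
  have xy : x != y.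
    apply/negP => /eqP xy; rewrite -xy in yj.
    by have := c_disj _ _ _ im jm xi yj; move: ij; lia.
  rewrite !inE [y == x]eq_sym xy /= [[set y; x]]setUC.
  have : c_ i != c_ j by rewrite nth_uniq ?ss // neq_ltn ij.
  by case: (eqVneq (f _) (c_ i)) => // -> /negPf ->.
have /(_ _ _ _ _ _ m0) := @doubling #|small_color| (fun j => #|A (c_ j)|%:R%R)
  (fun i j => (N (c_ i) (c_ j))%:R%R).
rewrite -natrX -natr_sum -!natrM ler_nat => dbl.
apply: leq_trans (leq_trans (dbl _ _ _ _ _) _).
- by rewrite leq_pmull // c_gt0.
- by move=> j jm; rewrite ltr0n c_gt0.
- by move=> i j ijm; rewrite ler_nat le_s.
- by move=> j jm; rewrite -natr_sum -natrX ler_nat N_le.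
- by move=> i j; rewrite ler0n.
- by move=> i j ijm; rewrite -natrM -natrD ler_nat N_ge.
by rewrite leq_mul2l le_sum orbT.
Qed.

(** The constant 8 is 6 from [large_colors] plus 2 from the factor 4 in [small_colors]. *)
Lemma posa_colors : 2 < #|T| -> (forall c, c \in f @: complete_edges T -> posa_set c) ->
  #|f @: complete_edges T| <= trunc_log 2 #|T| + 8.
Proof.
move=> T2 pE; have Lc := large_colors T2.
have sm : #|small_color| <= trunc_log 2 #|T| + 2.
  have := small_colors (ltn_trans (isT : 0 < 2) T2).
  have [|m2] := leqP #|small_color| 2; first by lia.
  rewrite -{1}(subnK (ltnW m2)) expnD mulnC leq_pmul2l // => /trunc_log_max.
  by lia.
have: f @: complete_edges T \subset
    small_color :|: [set c | posa_set c && (#|A c|.*2 == #|T|.-1)].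
  apply/subsetP => c /pE pc; rewrite !inE pc /=.
  by case/and3P: pc => _ lt _; rewrite orbC -leq_eqVlt -ltnS prednK // (ltn_trans _ T2).
move=> /subset_leq_card/leq_trans; apply.
by apply: leq_trans (leq_card_setU _ _) _; lia.
Qed.

End UpperBound.

Lemma poly_number_hamiltonian_le (T : finType) : 2 < #|T| ->
  poly_number (complete_edges T) [set F | @hamiltonian_cycle T F]
    <= trunc_log 2 #|T| + 8.
Proof.
move=> T2; apply/bigmax_leqP => f /forall_inP pf.
have fA c : exists A : {set T}, c \in f @: complete_edges T ->
    [&& 0 < #|A|, #|A|.*2 < #|T| & [forall v in A, #|off_color f c v| <= #|A|]].
  have [cE|_] := boolP (c \in f @: complete_edges T); last by exists set0.
  pose G := [set e in complete_edges T | f e != c].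
  have sG : G \subset complete_edges T by apply/subsetP => e /setIdP[].
  have nG : nonhamiltonian G.
    apply/forallP => F; apply/implyP => hF; apply/negP => /subsetP sF.
    have /pf/subsetP/(_ c cE)/imsetP[e /sF] : F \in [set F | hamiltonian_cycle F].
      by rewrite inE.
    by rewrite inE => /andP[_ /negP nfe] ce; apply: nfe; rewrite ce.
  have [i [A [i0 iT cA dA]]] := posa T2 sG nG.
  exists A => _; rewrite cA i0 iT; apply/forall_inP => v /dA; apply: leq_trans.
  rewrite leq_eqVlt; apply/orP; left; apply/eqP/eq_card => w.
  by rewrite !inE cards2; case: (v == w).
have [A pA] := fin_all_exists fA.
exact: posa_colors T2 pA.
Qed.

(** A member of [H] inside [E] makes all [k] colors occur on [E]; hence [k <= #|E|], and the colors
    embed in the palette of [poly_number]. *)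
Lemma poly_number_ge (T : finType) (E : {set {set T}})
  (H : {set {set {set T}}}) k (f : {set T} -> 'I_k) :
  (exists2 F, F \in H & F \subset E) ->
  (forall F c, F \in H -> c \in f @: F) -> k <= poly_number E H.
Proof.
move=> [F0 F0H sF0] pf.
have fE : f @: E = setT.
  by apply/setP => c; rewrite inE (subsetP (imsetS f sF0)) ?pf.
have kE : k <= #|E| by rewrite -[k]card_ord -cardsT -fE leq_imset_card.
pose g := [ffun e => widen_ord kE (f e)].
have gE (F : {set {set T}}) : g @: F = widen_ord kE @: (f @: F).
  by rewrite -imset_comp; apply: eq_imset => e; rewrite /= ffunE.
have gP : polychromatic E H g.
  apply/forall_inP => F FH; rewrite !gE; apply: imsetS.
  by apply/subsetP => c _; apply: pf.
have := @leq_bigmax_cond _ (fun g => polychromatic E H g) (fun g => #|g @: E|) g gP.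
rewrite /= gE card_imset ?fE ?cardsT ?card_ord //.
by move=> i j /(congr1 val) /= e; apply: val_inj.
Qed.

Lemma poly_number_sub (T : finType) (E : {set {set T}})
  (H H' : {set {set {set T}}}) :
  H' \subset H -> poly_number E H <= poly_number E H'.
Proof.
move=> sH; apply/bigmax_leqP => f /forall_inP pf.
apply: (@leq_bigmax_cond _ _ (fun g : {ffun _ -> _} => #|g @: E|)).
by apply/forall_inP => F /(subsetP sH)/pf.
Qed.

(** Each vertex of [X] sends two edges to [Y], and each vertex of [Y] receives at most two from [X].
    Equal sizes force exactly two everywhere. *)
Lemma two_factor_bipartite (T : finType) (F : {set {set T}}) (X Y : {set T}) :
  two_factor F -> {in X, forall x, nbrs F x \subset Y} ->
  #|X| <= #|Y| /\ (#|X| = #|Y| -> {in Y, forall y, nbrs F y \subset X}).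
Proof.
move=> tF nX.
have EX : #|X| * 2 = \sum_(y in Y) #|nbrs F y :&: X|.
  rewrite -sum_nat_const.
  transitivity (\sum_(x in X) \sum_(y in Y) (y \in nbrs F x : nat)).
    apply: eq_bigr => x /nX/subsetP sY; rewrite -(two_factor_nbrs x tF) -sum1_card.
    rewrite big_mkcond [RHS]big_mkcond; apply: eq_bigr => y _.
    by case: ifP => [/sY->|]; case: (y \in Y).
  rewrite exchange_big; apply: eq_bigr => y _ /=.
  rewrite setIC -sum1_card big_mkcond [RHS]big_mkcond; apply: eq_bigr => x _.
  by rewrite in_setI nbrs_sym; case: (x \in X).
have leY y : #|nbrs F y :&: X| <= 2.
  by rewrite -(two_factor_nbrs y tF) subset_leq_card ?subsetIl.
split; first by rewrite -(leq_pmul2r (ltn0Sn 1)) EX -sum_nat_const leq_sum.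
move=> XY y yY; apply/setIidPl/eqP; rewrite eqEcard subsetIl two_factor_nbrs //=.
rewrite leqNgt; apply/negP => lt; suff : #|X| * 2 < #|Y| * 2 by rewrite XY ltnn.
rewrite EX -sum_nat_const (bigD1 y) //= [X in _ < X](bigD1 y) //=.
by rewrite -addSn leq_add // leq_sum.
Qed.

Lemma card_ord_lt n a : a <= n -> #|[set i : 'I_n | i < a]| = a.
Proof.
move=> an; rewrite -[RHS]card_ord -!sum1_card (big_ord_widen _ (fun=> 1) an).
by apply: eq_bigl => i; rewrite inE.
Qed.

(** * Colorings by the first vertex of an edge *)

Section LowerBound.

Variables (n k : nat) (vc : nat -> nat).
Hypothesis n3 : 2 < n.
Hypothesis k3 : 2 < k.
Hypothesis vc_lt : forall i, vc i < k.
Hypothesis vc_id : forall i, i < 3 -> vc i = i.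

Let v0 : 'I_n := Ordinal (ltn_trans (ltn0Sn 1) n3).
Let v1 : 'I_n := Ordinal (ltn_trans (ltnSn 1) n3).
Let v2 : 'I_n := Ordinal n3.

(* On two vertices, the sum minus the maximum is the minimum: apart from the
   edge joining the first and third vertices, an edge inherits its color from
   its first vertex. *)
Definition edge_color (e : {set 'I_n}) : 'I_k :=
  if e == [set v0; v2] then Ordinal k3
  else Ordinal (vc_lt (\sum_(i in e) i - \max_(i in e) i)).

Lemma edge_color_lt (x y : 'I_n) : x < y -> (0 < x) || (y != 2 :> nat) ->
  edge_color [set x; y] = vc x :> nat.
Proof.
move=> xy xy02; have nxy : x \notin [set y].
  by rewrite inE -val_eqE neq_ltn xy.
rewrite /edge_color; case: eqP => [/setP e|_] /=.
  have := e x; have := e y; rewrite !inE !eqxx orbT -!val_eqE /=.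
  by move: xy xy02; lia.
by rewrite !big_setU1 // !big_set1 /= (maxn_idPr (ltnW xy)) ?addnK //.
Qed.

Variable F : {set {set 'I_n}}.
Hypothesis tF : two_factor F.

Let sF : F \subset complete_edges 'I_n.
Proof. by case/andP: tF. Qed.

Lemma other_neighbor v z : exists2 w, w \in nbrs F v & w != z.
Proof.
have : 0 < #|nbrs F v :\ z|.
  by have := cardsD1 z (nbrs F v); rewrite two_factor_nbrs //; case: (z \in _); lia.
by case/card_gt0P => w; rewrite !inE => /andP[]; exists w; rewrite ?inE.
Qed.

(** For colors 2, 1, 0, take at vertex 2, 1, 0 a neighbor other than 1, 0, 2 respectively. The
    neighbor of vertex 2 may be vertex 0, and then the exceptional edge supplies color 2. *)
Lemma edge_color_first (c : 'I_k) : c < 3 -> c \in edge_color @: F.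
Proof.
move=> c3; have [e eF ec] : exists2 e, e \in F & edge_color e = c :> nat; last first.
  by apply/imsetP; exists e => //; apply: val_inj.
move: c3; rewrite !ltnS leq_eqVlt ltnS leq_eqVlt ltnS leqn0 => /or3P[]/eqP->.
- have [w wn w1] := other_neighbor v2 v1; have vw := nbrs_neq sF wn.
  rewrite in_nbrs in wn; exists [set v2; w] => //.
  have [w0|w0] := posnP w.
    have -> : w = v0 by apply: val_inj.
    by rewrite /edge_color setUC eqxx.
  rewrite edge_color_lt ?vc_id //=.
  by move: w1 vw; rewrite -!val_eqE /=; lia.
- have [w wn w0] := other_neighbor v1 v0; have vw := nbrs_neq sF wn.
  rewrite in_nbrs in wn; exists [set v1; w] => //.
  rewrite edge_color_lt ?vc_id //=.
  by move: w0 vw; rewrite -!val_eqE /=; lia.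
have [w wn w2] := other_neighbor v0 v2; have vw := nbrs_neq sF wn.
rewrite in_nbrs in wn; exists [set v0; w] => //.
rewrite edge_color_lt ?vc_id //=.
by move: vw; rewrite -!val_eqE /=; lia.
Qed.

Lemma edge_color_block (c : 'I_k) a b : 2 < a <= b -> b <= n ->
  (forall i, a <= i < b -> vc i = c) -> c \notin edge_color @: F ->
  b - a <= a /\
  (b - a = a -> forall v : 'I_n, v < b -> nbrs F v \subset [set w : 'I_n | w < b]).
Proof.
move=> /andP[a2 ab] bn vcE cF.
pose X := [set i : 'I_n | a <= i < b]; pose Y := [set i : 'I_n | i < a].
(* Such an edge would inherit color [c] from [x]; it is not the exceptional edge, since
   [x >= a > 2]. *)
have nF (x y : 'I_n) : x \in nbrs F y -> a <= x < b -> x < y -> False.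
  rewrite nbrs_sym in_nbrs => xyF xab xy; case/negP: cF; apply/imsetP.
  exists [set x; y] => //; apply: val_inj; rewrite /= edge_color_lt ?vcE //.
  by move: xab a2; lia.
have nX : {in X, forall x, nbrs F x \subset Y}.
  move=> x; rewrite inE => xab; apply/subsetP => w wx; rewrite inE ltnNge.
  apply/negP => aw; have := nbrs_neq sF wx; rewrite -val_eqE neq_ltn.
  case/orP => lt; first by apply: (nF x w); rewrite // nbrs_sym.
  by case/andP: xab => _ xb; apply: (nF w x) => //; rewrite aw (ltn_trans lt xb).
have [cXY eXY] := two_factor_bipartite tF nX.
have cY : #|Y| = a.
  by apply: card_ord_lt; lia.
have cX : #|X| = b - a.
  rewrite -{1}(card_ord_lt bn) -[in RHS]cY -cardsDS.
    by apply: eq_card => i; rewrite !inE -leqNgt.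
  by apply/subsetP => i; rewrite !inE; lia.
rewrite cX cY in cXY eXY; split=> // /eXY nY v vb.
have [av|va] := leqP a v.
  have vX : v \in X by rewrite inE av.
  by apply: fintype.subset_trans (nX v vX) _; apply/subsetP => w; rewrite !inE; lia.
have vY : v \in Y by rewrite inE.
by apply: fintype.subset_trans (nY v vY) _; apply/subsetP => w;
  rewrite !inE => /andP[].
Qed.

End LowerBound.

(** * Choice of the blocks for 2-factors and for Hamiltonian cycles *)

Lemma hamiltonian_complete n : 2 < n -> exists2 F, F \in HC n & F \subset K n.
Proof.
move=> n3; have [|F hF] := @hamiltonian_exists 'I_n; first by rewrite card_ord.
by exists F; rewrite ?inE //; case/andP: (hamiltonian_two_factor hF).
Qed.

Lemma poly_F2_le_HC n : poly_number (K n) (F2 n) <= poly_number (K n) (HC n).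
Proof.
by apply: poly_number_sub; apply/subsetP => F; rewrite !inE; apply: hamiltonian_two_factor.
Qed.

(* Color [c > 2] is given to the vertices of [2^(c-1) - 1, 2^c - 1), a majority
   of the vertices below [2^c - 1]. *)
Lemma poly_F2_ge n k : 2 < n -> 2 < k -> 2 ^ k.-1 <= n.+1 ->
  k <= poly_number (K n) (F2 n).
Proof.
move=> n3 k3 kn.
(* The minimum gives the last color to all vertices beyond the last block. *)
pose vc i := if i < 3 then i else minn k.-1 (trunc_log 2 i.+1).+1.
have vc_lt i : vc i < k by rewrite /vc; case: ifP; lia.
have vc_id i : i < 3 -> vc i = i by rewrite /vc => ->.
apply: (@poly_number_ge _ _ _ _ (edge_color n3 k3 vc_lt)).
  have [F FH FK] := hamiltonian_complete n3; exists F => //.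
  by move: FH; rewrite !inE; apply: hamiltonian_two_factor.
move=> F c; rewrite inE => tF; have [c3|c3] := ltnP c 3.
  exact: edge_color_first.
apply/negPn/negP => cF.
have eE : 2 ^ c = 2 * 2 ^ c.-1 by rewrite -expnS prednK //; lia.
have e4 : 2 ^ 2 <= 2 ^ c.-1 by rewrite leq_exp2l //; lia.
have ek : 2 ^ c <= 2 ^ k.-1 by rewrite leq_exp2l //; have := ltn_ord c; lia.
have [||||] := @edge_color_block _ _ _ n3 k3 vc_lt F tF c (2 ^ c.-1 - 1) (2 ^ c - 1).
- by apply/andP; lia.
- by lia.
- move=> i /andP[ai ib]; have -> : vc i = minn k.-1 (trunc_log 2 i.+1).+1.
    by rewrite /vc ifN //; lia.
  rewrite (@trunc_log_eq 2 c.-1) //; first by have := ltn_ord c; lia.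
  by rewrite prednK; [apply/andP; lia|lia].
- exact: cF.
by move=> + _; lia.
Qed.

(* Color [c > 2] is given to the vertices of [3 * 2^(c-3), 3 * 2^(c-2)), half
   of the vertices below [3 * 2^(c-2)]. *)
Lemma poly_HC_ge n k : 2 < k -> 3 * 2 ^ (k - 3) < n ->
  k <= poly_number (K n) (HC n).
Proof.
move=> k3 kn; have n3 : 2 < n by have := expn_gt0 2 (k - 3); lia.
pose vc i := if i < 3 then i else minn k.-1 (trunc_log 2 (i %/ 3) + 3).
have vc_lt i : vc i < k by rewrite /vc; case: ifP; lia.
have vc_id i : i < 3 -> vc i = i by rewrite /vc => ->.
apply: (@poly_number_ge _ _ _ _ (edge_color n3 k3 vc_lt)).
  exact: hamiltonian_complete.
move=> F c; rewrite inE => hF; have tF := hamiltonian_two_factor hF.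
have [c3|c3] := ltnP c 3; first exact: edge_color_first.
apply/negPn/negP => cF; set a := 3 * 2 ^ (c - 3).
have e1 : 0 < 2 ^ (c - 3) by rewrite expn_gt0.
have ek : 2 * 2 ^ (c - 3) <= 2 ^ (k - 3).
  by rewrite -expnS leq_exp2l //; have := ltn_ord c; lia.
have ek' : 2 * a < n by rewrite /a; lia.
have [||||cl1 cl2] := @edge_color_block _ _ _ n3 k3 vc_lt F tF c a (2 * a).
- by rewrite /a; apply/andP; lia.
- by lia.
- move=> i /andP[ai ib]; have -> : vc i = minn k.-1 (trunc_log 2 (i %/ 3) + 3).
    by rewrite /vc ifN //; lia.
  rewrite (@trunc_log_eq 2 (c - 3)) //; first by have := ltn_ord c; lia.
  by rewrite expnS; apply/andP; lia.
- exact: cF.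
(* By the equality case, [F] has no edge leaving [[0, 2a)], so this set would contain every vertex;
   but [2a < n] leaves the vertex [2a] outside. *)
have /setP/(_ (Ordinal ek')) : [set w : 'I_n | w < 2 * a] = setT.
  apply: (hamiltonian_closed (z := Ordinal (ltn_trans (ltn0Sn 1) n3)) hF).
    by rewrite inE /=; lia.
  by move=> v; rewrite inE => /cl2; apply; lia.
by rewrite !inE /= ltnn.
Qed.

(** * Comparing the real logarithm with integer exponents *)

Section FloorLog2.

Variable R : realType.
Local Open Scope ring_scope.

Let ln2 : 0 < ln (2 : R).
Proof. by rewrite ln_gt0 // ltr1n. Qed.

Lemma floor_log2_le (x : R) k : 0 < x -> x < 2 ^+ k.+1 -> floor_log2 x <= k%:Z.
Proof.
move=> x0 xk; rewrite /floor_log2 -ltzD1 floor_lt_int ltr_pdivrMr //.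
rewrite -[(_ + 1)%R]/(k%:Z + 1%:Z) -PoszD addn1 -pmulrn mulr_natl -lnXn //.
by rewrite ltr_ln ?posrE ?exprn_gt0.
Qed.

Lemma floor_log2_ge (x : R) k : 2 ^+ k <= x -> k%:Z <= floor_log2 x.
Proof.
move=> xk; rewrite /floor_log2 floor_ge_int ler_pdivlMr // -pmulrn mulr_natl -lnXn //.
by rewrite ler_ln ?posrE ?exprn_gt0 // (lt_le_trans _ xk) ?exprn_gt0.
Qed.

End FloorLog2.

Local Open Scope ring_scope.

Theorem theorem2 (R : realType) :
  (exists c : int, forall n : nat, (3 <= n)%N ->
     [/\ floor_log2 (2 * (n%:R + 1) : R) <= (poly_number (K n) (F2 n))%:Z,
         (poly_number (K n) (F2 n) <= poly_number (K n) (HC n))%N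
       & (poly_number (K n) (HC n))%:Z <= floor_log2 (n%:R : R) + c])
  /\
  (forall n : nat, (3 <= n)%N ->
     floor_log2 (8 * (n%:R - 1) / 3 : R) <= (poly_number (K n) (HC n))%:Z).
Proof.
have F2_ge (n : nat) : (3 <= n)%N ->
    (trunc_log 2 (2 * n.+1) <= poly_number (K n) (F2 n))%N.
  move=> n3; have kn := @trunc_logP 2 (2 * n.+1) isT isT.
  have k3 : (3 <= trunc_log 2 (2 * n.+1))%N by apply: trunc_log_max => //; lia.
  apply: poly_F2_ge => //.
  by rewrite -(leq_pmul2l (ltn0Sn 1)) -expnS prednK //; lia.
split.
  exists 8%:Z => n n3; split.
  - apply: le_trans (_ : (trunc_log 2 (2 * n.+1))%:Z <= _); last first.
      by rewrite lez_nat F2_ge.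
    apply: floor_log2_le; first by rewrite mulr_gt0 // ltr_wpDl.
    by rewrite natr1 -natrM -natrX ltr_nat trunc_log_ltn.
  - exact: poly_F2_le_HC.
  have := @poly_number_hamiltonian_le 'I_n; rewrite card_ord => /(_ n3) le8.
  apply: (@le_trans _ _ (trunc_log 2 n + 8)%N%:Z); first by rewrite lez_nat.
  rewrite PoszD lerD2r; apply: floor_log2_ge.
  by rewrite -natrX ler_nat trunc_logP //; lia.
move=> n n3; pose k := trunc_log 2 (8 * n.-1 %/ 3).
have n1 : n%:R - 1 = n.-1%:R :> R by rewrite -[in LHS](prednK (n := n)) -?natr1 ?addrK //; lia.
apply: (@le_trans _ _ k%:Z).
  apply: floor_log2_le; first by rewrite n1 divr_gt0 // mulr_gt0 // ltr0n; lia.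
  rewrite n1 ltr_pdivrMr // -natrM -natrX -natrM ltr_nat -ltn_divLR //.
  exact: trunc_log_ltn.
rewrite lez_nat.
(* For [n = 3] the exponent [k] is only 2, outside the range of [poly_HC_ge]; the coloring for
   2-factors already has 3 colors. *)
have [n4|n4] := ltnP n 4.
  have nE : n = 3%N by lia.
  apply: leq_trans (poly_F2_le_HC n); apply: (@leq_trans 3).
    by rewrite /k nE.
  by apply: poly_F2_ge; rewrite ?nE.
have kn : (3 * 2 ^ k <= 8 * n.-1)%N.
  by rewrite mulnC -leq_divRL // trunc_logP //; lia.
have k3 : (3 <= k)%N by apply: trunc_log_max => //; lia.
apply: poly_HC_ge => //.
have : (2 ^ k = 8 * 2 ^ (k - 3))%N by rewrite -(expnD 2 3) subnKC.
lia.
Qed.
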